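(* Let $I$ be a nonempty finite set, let $(\omega_i)_{i\in I}$ be real numbers in $]0,1]$ such that $\sum_{i\in I}\omega_i=1$, and let $C$ be a nonempty closed convex subset of a real Hilbert space $\mathcal H$. For every $i\in I$, let $\mathcal G_i$ be a real Hilbert space, let $p_i\in\mathcal G_i$, let $L_i\colon\mathcal H\to\mathcal G_i$ be a nonzero bounded linear operator, and let $F_i\colon\mathcal G_i\to\mathcal G_i$ be a firmly nonexpansive operator. Consider the problem $$\text{find } x\in C \text{ such that } (\forall y\in C)\quad \sum_{i\in I}\omega_i\langle L_i(y-x)\mid F_i(L_ix)-p_i\rangle\geq 0. \qquad (P)$$ Then $(P)$ admits a solution in each of the following instances: (i) $\sum_{i\in I}\omega_iL_i^*p_i\in\operatorname{ran}\big(N_C+\sum_{i\in I}\omega_iL_i^*\circ F_i\circ L_i\big)$. (ii) $C$ is bounded. (iii) $\operatorname{ran}N_C+\sum_{i\in I}\omega_iL_i^*(\operatorname{ran}F_i)=\mathcal H$. (iv) For some $i\in I$, $L_i^*$ is surjective and one of the following holds: (a) $L_i^*(\operatorname{ran}F_i)=\mathcal H$. (b) $F_i$ is surjective. (c) $\|F_i(y)\|\to+\infty$ as $\|y\|\to+\infty$. (d) $\operatorname{ran}(\mathrm{Id}-F_i)$ is bounded. (e) There exists a continuous convex function $g_i\colon\mathcal G_i\to\mathbb R$ such that $F_i=\operatorname{prox}_{g_i}$.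
   Context: An operator $F\colon\mathcal G\to\mathcal G$ on a real Hilbert space is firmly nonexpansive if $\langle x-y\mid Fx-Fy\rangle\geq\|Fx-Fy\|^2$ for all $x,y\in\mathcal G$. $\mathrm{Id}$ is the identity operator and $L_i^*$ is the adjoint of $L_i$. The normal cone operator $N_C\colon\mathcal H\to 2^{\mathcal H}$ is $N_Cx=\{x^*\in\mathcal H\mid(\forall y\in C)\ \langle y-x\mid x^*\rangle\leq 0\}$ if $x\in C$, and $N_Cx=\varnothing$ otherwise. The range of a set-valued operator $A\colon\mathcal H\to 2^{\mathcal H}$ is $\operatorname{ran}A=\{x^*\mid(\exists x\in\mathcal H)\ x^*\in Ax\}$; single-valued operators are identified with set-valued ones having singleton values, and sums of sets are Minkowski sums. For a proper lower semicontinuous convex function $g\colon\mathcal G\to\,]-\infty,+\infty]$ and $x\in\mathcal G$, $\operatorname{prox}_gx$ is the unique minimizer over $y\in\mathcal G$ of $g(y)+\|x-y\|^2/2$. *)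

(* Defs.v *)
From HB Require Import structures.
From mathcomp Require Import all_boot all_order all_algebra.
From mathcomp Require Import sesquilinear.
From mathcomp Require Import all_classical all_reals all_analysis.
From mathcomp Require Import ring lra.

Set Implicit Arguments.
Unset Strict Implicit.
Unset Printing Implicit Defensive.

Import Order.TTheory GRing.Theory Num.Theory.
Import numFieldNormedType.Exports.

Local Open Scope classical_set_scope.
Local Open Scope ring_scope.

HB.mixin Record NormedModule_hasInner (R : realType) V & NormedModule R V := {
  inner : {dot V for (@idfun R)};
  norm_innerE : forall x : V, `|x| = Num.sqrt (inner x x)
}.

#[short(type="hilbertType")]
HB.structure Definition Hilbert (R : realType) :=
  {V of CompleteNormedModule R V & NormedModule_hasInner R V}.

Section InnerTheory.
Context {R : realType} {H : hilbertType R}.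
Implicit Types x y z : H.

Lemma innerC x y : inner x y = inner y x.
Proof. by rewrite hermC expr0 mul1r. Qed.

Lemma innerDl x y z : inner (x + y) z = inner x z + inner y z.
Proof. exact: linearDl. Qed.

Lemma innerZl a x y : inner (a *: x) y = a * inner x y.
Proof. exact: linearZl_LR. Qed.

Lemma innerNl x y : inner (- x) y = - inner x y.
Proof. exact: linearNl. Qed.

Lemma innerDr x y z : inner x (y + z) = inner x y + inner x z.
Proof. by rewrite innerC innerDl !(innerC x). Qed.

Lemma innerZr a x y : inner x (a *: y) = a * inner x y.
Proof. by rewrite innerC innerZl innerC. Qed.

Lemma innerNr x y : inner x (- y) = - inner x y.
Proof. by rewrite innerC innerNl innerC. Qed.

Definition innerE :=
  (innerDl, innerDr, innerNl, innerNr, innerZl, innerZr).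

Lemma inner0l x : inner 0 x = 0.
Proof. by rewrite -(scale0r x) innerZl mul0r. Qed.

Lemma inner_ge0 x : 0 <= inner x x.
Proof.
have [->|x0] := eqVneq x 0; first by rewrite inner0l.
by apply: ltW; apply: neq0_dnorm_gt0.
Qed.

Lemma sqr_normE x : `|x| ^+ 2 = inner x x.
Proof. by rewrite norm_innerE sqr_sqrtr// inner_ge0. Qed.

Lemma inner_le x y : inner x y <= `|x| * `|y|.
Proof.
have [->|x0] := eqVneq x 0; first by rewrite inner0l normr0 mul0r.
have [->|y0] := eqVneq y 0; first by rewrite innerC inner0l normr0 mulr0.
have xy0 : 0 < `|x| * `|y| by rewrite mulr_gt0// normr_gt0.
have := inner_ge0 (`|y| *: x - `|x| *: y).
rewrite !innerE (innerC y x) -!sqr_normE => h.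
by rewrite -subr_ge0 -(pmulr_rge0 _ xy0); nra.
Qed.

Lemma normr_inner_le x y : `|inner x y| <= `|x| * `|y|.
Proof.
by rewrite ler_norml inner_le andbT lerNl -innerNl -(normrN x) inner_le.
Qed.

End InnerTheory.

Section Riesz.
Context {R : realType} {H : hilbertType R}.
Variables (phi : H -> R) (K : R).
Hypothesis phiD : forall x y, phi (x + y) = phi x + phi y.
Hypothesis phiZ : forall a x, phi (a *: x) = a * phi x.
Hypothesis phiK : forall x, `|phi x| <= K * `|x|.

Let J x := `|x| ^+ 2 / 2 - phi x.
Let m := inf (range J).

Let J_has_inf : has_inf (range J).
Proof.
split; first by exists (J 0), 0.
exists (- K ^+ 2 / 2) => _ [x _ <-]; rewrite /J.
have := phiK x; rewrite ler_norml => /andP[_ h].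
by have := sqr_ge0 (`|x| - K); nra.
Qed.

Let m_le x : m <= J x.
Proof. by apply: ge_inf; [exact: J_has_inf.2|exists x]. Qed.

Let J_near e : 0 < e -> exists x, J x < m + e.
Proof.
by move=> e0; have [_ [x _ <-] h] := inf_adherent e0 J_has_inf; exists x.
Qed.

Let J_parallelogram x y : `|x - y| ^+ 2 <= 4 * (J x + J y - 2 * m).
Proof.
have := m_le (2^-1 *: (x + y)).
rewrite /J !sqr_normE !innerE (innerC y x) phiZ phiD; lra.
Qed.

Let J_grad d x h : 0 <= d -> J x < m + d ^+ 2 / 2 ->
  `|inner x h - phi h| <= d * `|h|.
Proof.
move=> d0 Jx.
have [->|h0] := eqVneq h 0.
  have phi0 : phi 0 = 0 by rewrite -(scale0r x) phiZ mul0r.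
  by rewrite innerC inner0l phi0 subrr !normr0 mulr0.
have nh : 0 < `|h| by rewrite normr_gt0.
rewrite -ler_sqr ?nnegrE ?mulr_ge0// real_normK ?num_real//.
set D := inner x h - phi h.
have Jt t : J (x + t *: h) = J x + t * D + t ^+ 2 * `|h| ^+ 2 / 2.
  by rewrite /J /D !sqr_normE !innerE (innerC h x) phiD phiZ; field.
have := m_le (x + (- (D / `|h| ^+ 2)) *: h).
have -> : J (x + (- (D / `|h| ^+ 2)) *: h) = J x - (D ^+ 2 / `|h| ^+ 2) / 2.
  by rewrite Jt; field; rewrite gt_eqF.
move=> h1; have : D ^+ 2 / `|h| ^+ 2 <= d ^+ 2 by lra.
by rewrite ler_pdivrMr ?exprn_gt0// -exprMn.
Qed.

Lemma riesz : exists z, forall x, phi x = inner x z.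
Proof.
pose F := filter_from [set d : R | 0 < d]
  (fun d => [set x | J x < m + d ^+ 2 / 2]).
have FF : ProperFilter F.
  apply: filter_from_proper.
    apply: filter_from_filter; first by exists 1 => /=.
    move=> a b /= a0 b0; exists (Num.min a b) => /=; first by rewrite lt_min a0.
    have c0 : 0 <= Num.min a b by rewrite le_min !ltW.
    move=> x /= Jx; split; apply: lt_le_trans Jx _; rewrite lerD2l.
      by rewrite ler_pM2r ?invr_gt0// lerXn2r ?nnegrE ?(ltW a0)// ge_min lexx.
    by rewrite ler_pM2r ?invr_gt0// lerXn2r ?nnegrE ?(ltW b0)// ge_min lexx orbT.
  by move=> d /= d0; apply: J_near; rewrite divr_gt0// exprn_gt0.
have Fc : cauchy F.
  apply: cauchy_exP => _/posnumP[e].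
  have e40 : 0 < e%:num / 4 by rewrite divr_gt0.
  have [x Jx] : exists x, J x < m + (e%:num / 4) ^+ 2 / 2.
    by apply: J_near; rewrite divr_gt0// exprn_gt0.
  exists x, (e%:num / 4) => //= y /= Jy; rewrite -ball_normE /=.
  rewrite -ltr_sqr ?nnegrE//; apply: le_lt_trans (J_parallelogram _ _) _.
  have : 0 < e%:num ^+ 2 by rewrite exprn_gt0.
  nra.
have Fl : F --> lim F by apply: cauchy_cvg.
exists (lim F) => h; apply/eqP; rewrite innerC eq_sym -subr_eq0 -normr_le0.
apply/ler_addgt0Pr => e e0; rewrite add0r.
pose d := e / (2 * (`|h| + 1)).
have h1 : 0 < `|h| + 1 by rewrite ltr_wpDl.
have d0 : 0 < d by rewrite divr_gt0// mulr_gt0.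
have : \forall x \near F, `|lim F - x| < d /\ J x < m + d ^+ 2 / 2.
  near=> x; split; last by near: x; exists d.
  by near: x; exact: (@cvgr_dist_lt _ _ _ F FF id _ Fl).
move=> /filter_ex[x [lx Jx]].
have -> : inner (lim F) h - phi h = inner (lim F - x) h + (inner x h - phi h).
  by rewrite !innerE addrA subrK.
apply: le_trans (ler_normD _ _) _.
apply: le_trans (lerD (normr_inner_le _ _) (J_grad h (ltW d0) Jx)) _.
have -> : e = 2 * (d * (`|h| + 1)) by rewrite /d; field; rewrite gt_eqF.
have : `|lim F - x| * `|h| <= d * `|h| by rewrite ler_wpM2r// ltW.
by have := d0; lra.
Unshelve. all: by end_near. Qed.

End Riesz.

Section Operators.
Context {R : realType}.
Implicit Types H G : hilbertType R.

Definition bounded_operator H G (L : H -> G) :=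
  exists M : R, forall x, `|L x| <= M * `|x|.

(* The vector z below is unique, and [adjointP] shows that it exists as soon as
   L is linear and bounded; 0 is a default value for all other maps L. *)
Definition adjoint H G (L : H -> G) (y : G) : H :=
  xget 0 [set z | forall x, inner (L x) y = inner x z].

Lemma adjointP H G (L : {linear H -> G}) : bounded_operator L ->
  forall x y, inner (L x) y = inner x (adjoint L y).
Proof.
move=> [M LM] x y; rewrite /adjoint; case: xgetP => [z _ -> //|noz].
have [|a u|u|z Lz] := @riesz R H (fun u => inner (L u) y) (M * `|y|).
- by move=> u v; rewrite linearD innerDl.
- by rewrite linearZ_LR innerZl.
- apply: le_trans (normr_inner_le _ _) _.
  by rewrite mulrAC ler_wpM2r.
- by case: (noz z).
Qed.

Definition firmly_nonexpansive G (F : G -> G) :=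
  forall x y, `|F x - F y| ^+ 2 <= inner (x - y) (F x - F y).

Definition normal_cone H (C : set H) (x : H) : set H :=
  [set u | C x /\ forall y, C y -> inner (y - x) u <= 0].

Definition single_valued H (f : H -> H) (x : H) : set H := [set f x].

Definition setadd H (A B : set H) : set H := [set a + b | a in A & b in B].

Definition setsum H (I : finType) (A : I -> set H) : set H :=
  [set u | exists2 a : I -> H, forall i, A i (a i) & u = \sum_i a i].

Definition opadd H (A B : H -> set H) (x : H) : set H := setadd (A x) (B x).

Definition ran H (A : H -> set H) : set H := [set u | exists x, A x u].

(* This is the proximal point whenever g is proper, lower semicontinuous and
   convex, the minimizer being then unique; 0 is a default value for functions
   without a minimizer. *)
Definition prox G (g : G -> \bar R) (x : G) : G :=
  xget 0 [set p | forall y, (g p + (`|x - p| ^+ 2 / 2)%:E <=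
                             g y + (`|x - y| ^+ 2 / 2)%:E)%E].

Definition norm_coercive G (F : G -> G) :=
  forall M : R, exists N : R, forall y, N < `|y| -> M < `|F y|.

Definition VI_solution H (I : finType) (G : I -> hilbertType R) (omega : I -> R)
    (C : set H) (p : forall i, G i) (L : forall i, {linear H -> G i})
    (F : forall i, G i -> G i) : set H :=
  [set x | C x /\ forall y, C y ->
     0 <= \sum_i omega i * inner (L i (y - x)) (F i (L i x) - p i)].

End Operators.

(* Main.v *)
(* Problem (P) is the variational inequality on C for the cocoercive operator
   B x = sum_i omega_i L_i^* (F_i (L_i x) - p_i).  Replacing B by B + e Id with
   e > 0 makes it uniquely solvable, by Banach's fixed point theorem applied to
   a projected forward step, and if the solutions x_e stay bounded as e -> 0 then
   they converge to a solution of (P): for d < e monotonicity gives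
   |x_e - x_d|^2 <= |x_d|^2 - |x_e|^2, so the path is Cauchy.  Under (iii) the
   path is bounded by the Brezis-Haraux argument: writing a vector target + w as
   an element of ran N_C + sum_i omega_i L_i^* (ran F_i) bounds <x_e | w> above,
   and the uniform boundedness principle applies.  The cases of (iv) reduce
   to (iii) once F_i is known to be surjective, which is again proved by bounding
   the solutions of F_i x + e x = y. *)
Require Import Defs.
From HB Require Import structures.
From mathcomp Require Import all_boot all_order all_algebra.
From mathcomp Require Import all_classical all_reals all_analysis.
From mathcomp Require Import ring lra.
Set Implicit Arguments.
Unset Strict Implicit.
Unset Printing Implicit Defensive.
Import Order.TTheory GRing.Theory Num.Theory.
Import numFieldNormedType.Exports.
Local Open Scope classical_set_scope.
Local Open Scope ring_scope.

(** * Limits of norms and inner products in a Hilbert space *)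

Section HilbertLimits.
Context {R : realType} {H : hilbertType R}.
Implicit Types (x y : H) (u v : nat -> H).

Lemma inner_eq0 x : (forall y, 0 <= inner y x) -> x = 0.
Proof.
move=> /(_ (- x)); rewrite innerNl -sqr_normE oppr_ge0 => x0.
by apply/eqP; rewrite -normr_eq0 -sqrf_eq0 eq_le x0 sqr_ge0.
Qed.

Lemma sqr_normB x y : `|x - y| ^+ 2 = `|x| ^+ 2 - 2 * inner x y + `|y| ^+ 2.
Proof. by rewrite !sqr_normE !innerE (innerC y x); ring. Qed.

Lemma cvg_sqr_norm u x : u @ \oo --> x ->
  (fun n => `|u n| ^+ 2) @ \oo --> `|x| ^+ 2.
Proof. by move=> /cvg_norm nux; rewrite expr2; exact: (cvgM nux nux). Qed.

Lemma cvg_inner u v x y : u @ \oo --> x -> v @ \oo --> y ->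
  (fun n => inner (u n) (v n)) @ \oo --> inner x y.
Proof.
move=> ux vy.
have polar a b : inner a b = (`|a + b| ^+ 2 - `|a - b| ^+ 2) / 4 :> R.
  by rewrite !sqr_normE !innerE (innerC b a); field.
rewrite polar (_ : (fun n => _) = fun n =>
  (`|u n + v n| ^+ 2 - `|u n - v n| ^+ 2) / 4); last exact/funext.
apply: cvgMl; apply: cvgB; apply: cvg_sqr_norm; first exact: cvgD ux vy.
exact: cvgB ux vy.
Qed.

Lemma is_cvg_sqr_dist u (e : nat -> R) : e @ \oo --> 0 ->
  (forall n k, (n <= k)%N -> `|u n - u k| ^+ 2 <= e n) -> cvgn u.
Proof.
move=> e0 ue; apply: cauchy_cvg; apply: cauchy_exP => d d0.
have d20 : 0 < d ^+ 2 by rewrite exprn_gt0.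
have [N _ eN] := cvgr_lt 0 e0 _ d20.
exists (u N), N => //= k Nk; rewrite -ball_normE /=.
rewrite -ltr_sqr ?nnegrE ?(ltW d0)//.
by apply: le_lt_trans (ue _ _ Nk) _; exact: (eN N (leqnn N)).
Qed.

End HilbertLimits.

(** * Minimizing a convex function plus a squared distance *)

Section ProximalMinimization.
Context {R : realType} {H : hilbertType R}.
Implicit Types (x y : H) (C : set H) (g : H -> R).

Lemma convex_setE C x y t : convex_set C -> C x -> C y -> 0 <= t <= 1 ->
  C (x + t *: (y - x)).
Proof.
move=> cC Cx Cy t01; have := cC y x (Itv01 (andP t01).1 (andP t01).2).
rewrite !inE => /(_ Cy Cx); congr C.
rewrite /conv /= /unstable.onem scalerBr scalerBl scale1r.
by rewrite addrCA.
Qed.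

Lemma convex_functionE g x y t : convex_function setT g -> 0 <= t <= 1 ->
  g (x + t *: (y - x)) <= g x + t * (g y - g x).
Proof.
move=> cg t01; have := cg (Itv01 (andP t01).1 (andP t01).2) y x.
rewrite !inE => /(_ I I); rewrite convRE /conv /= /unstable.onem.
have -> : t *: y + (1 - t) *: x = x + t *: (y - x).
  by rewrite scalerBr scalerBl scale1r addrCA.
by move=> h; apply: (le_trans h); lra.
Qed.

(** Continuity bounds [g] below on a ball around 0; along the segment from 0 to [y], convexity lets
    [g] decrease at most linearly. This makes proximal objectives bounded below. *)
Lemma convex_minorant g : continuous g -> convex_function setT g ->
  exists2 K, 0 <= K & forall y, - (K * (1 + `|y|)) <= g y.
Proof.
move=> gcont gconv.
have /nbhs_ballP[d /= d0 gd] : \forall y \near (0 : H), `|g 0 - g y| < 1.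
  exact: cvgr_dist_lt (gcont 0) _ ltr01.
have gball y : `|y| < d -> g 0 - 1 < g y.
  move=> yd; have : ball (0 : H) d y by rewrite -ball_normE /= sub0r normrN.
  by move=> /gd /=; rewrite ltr_norml; lra.
exists (`|g 0| + 1 + 2 / d); first by rewrite !addr_ge0// divr_ge0// ltW.
move=> y; have dI : 0 < 2 / d by rewrite divr_gt0.
have g0 : - `|g 0| <= g 0 by have := lerNnormlW (lexx `|g 0|); lra.
have y0 := normr_ge0 y; have g00 := normr_ge0 (g 0).
have [yd|dy] := ltP `|y| d; first by have := gball _ yd; nra.
have yp : 0 < `|y| by apply: lt_le_trans dy.
(* [t *: y] has norm [d / 2], hence lies in the ball where [g] exceeds [g 0 - 1]. *)
pose t := d / 2 / `|y|.
have t0 : 0 < t by rewrite !divr_gt0.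
have t1 : t <= 1 by rewrite ler_pdivrMr// mul1r; lra.
have := @convex_functionE g 0 y t gconv; rewrite t1 ltW//= => /(_ isT).
rewrite subr0 add0r => gt.
have /gball : `|t *: y| < d.
  rewrite normrZ gtr0_norm// /t divfK ?gt_eqF//; lra.
move=> gt'; have : t * (g 0 - g y) <= 1 by nra.
rewrite mulrC -ler_pdivlMr// /t => h.
have : 1 / (d / 2 / `|y|) = 2 / d * `|y| by field; rewrite !gt_eqF.
by move=> h2; rewrite h2 in h; nra.
Qed.

(** The quadratic term makes the objective strongly convex, so minimizing sequences are Cauchy.
    Taking [g = 0] gives projections onto [C]; taking [C = setT] gives proximal points. *)
Lemma prox_minimizer_exists g C x : continuous g -> convex_function setT g ->
  closed C -> convex_set C -> C !=set0 ->
  exists2 q, C q & forall y, C y ->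
    g q + `|x - q| ^+ 2 / 2 <= g y + `|x - y| ^+ 2 / 2.
Proof.
move=> gcont gconv Cclosed Cconv [c0 Cc0].
pose J y := g y + `|x - y| ^+ 2 / 2.
have infJ : has_inf (J @` C).
  split; first by exists (J c0), c0.
  have [K K0 gK] := convex_minorant gcont gconv.
  exists (- (K * (1 + `|x|) + K ^+ 2 / 2)) => _ [y Cy <-]; rewrite /J.
  have := gK y; have : `|y| <= `|x| + `|x - y|.
    by rewrite -[in leLHS](subKr x y); exact: ler_normB.
  by have := sqr_ge0 (`|x - y| - K); nra.
set m := inf (J @` C).
have mle y : C y -> m <= J y.
  by move=> Cy; apply: ge_inf; [exact: infJ.2|exists y].
have /choice [u uP] : forall n, exists y, C y /\ J y < m + n.+1%:R^-1.
  move=> n; have n0 : 0 < n.+1%:R^-1 :> R by rewrite invr_gt0.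
  by have [_ [y Cy <-] Jy] := inf_adherent n0 infJ; exists y.
(* Parallelogram law, with [m] compared to the objective at the midpoint, which lies in [C]. *)
have midpoint y z : C y -> C z -> `|y - z| ^+ 2 <= 4 * (J y + J z - 2 * m).
  move=> Cy Cz; have h01 : 0 <= (2^-1 : R) <= 1.
    by rewrite invr_ge0 ler0n invf_le1 ?ler1n.
  have := mle _ (convex_setE Cconv Cy Cz h01).
  have := convex_functionE y z gconv h01.
  rewrite /J !sqr_normE !innerE (innerC x y) (innerC x z) (innerC z y); lra.
have inv0 : (fun n => 8 * n.+1%:R^-1 : R) @ \oo --> (0 : R).
  by rewrite -[0](mulr0 8); apply: cvgMr; exact: cvg_harmonic.
have ucvg : cvgn u.
  apply: (is_cvg_sqr_dist inv0) => n k nk.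
  have [Cn Jn] := uP n; have [Ck Jk] := uP k.
  have : k.+1%:R^-1 <= n.+1%:R^-1 :> R by rewrite lef_pV2 ?posrE// ler_nat.
  move: Jn Jk (midpoint _ _ Cn Ck).
  move: (n.+1%:R^-1) (k.+1%:R^-1) => a b; lra.
exists (limn u).
  by apply: closed_cvg ucvg => //; apply: nearW => n; exact: (uP n).1.
move=> y Cy; apply: le_trans (mle _ Cy).
have Ju : (fun n => J (u n)) @ \oo --> J (limn u).
  apply: cvgD; first by apply: cvg_comp ucvg _; exact: gcont.
  apply: cvgMl; apply: cvg_sqr_norm; apply: cvgB ucvg; exact: cvg_cst.
have mu : (fun n => m + n.+1%:R^-1) @ \oo --> m.
  rewrite -[m in _ --> m]addr0.
  by apply: cvgD; [exact: cvg_cst|exact: cvg_harmonic].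
by apply: ler_cvg_to Ju mu _; apply: nearW => n; exact/ltW/(uP n).2.
Qed.

(** First-order optimality: compare [q] with [q + t *: (y - q)], divide by [t] and let [t] tend to
    0. *)
Lemma prox_variational g C x q : convex_function setT g -> convex_set C ->
  C q -> (forall y, C y ->
    g q + `|x - q| ^+ 2 / 2 <= g y + `|x - y| ^+ 2 / 2) ->
  forall y, C y -> inner (y - q) (x - q) <= g y - g q.
Proof.
move=> gconv Cconv Cq qmin y Cy; apply/ler_addgt0Pr => e e0.
have n1 : 0 < `|y - q| ^+ 2 + 1 by rewrite ltr_wpDl// sqr_ge0.
(* Small enough for the second-order term to be at most [t * e]; the added 1 keeps the denominator
   positive. *)
pose t := Num.min 1 (e / (`|y - q| ^+ 2 + 1)).
have t0 : 0 < t by rewrite lt_min ltr01 divr_gt0.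
have t01 : 0 <= t <= 1 by rewrite ltW//= ge_min lexx.
have te : t * (`|y - q| ^+ 2 + 1) <= e.
  by rewrite -ler_pdivlMr// ge_min lexx orbT.
have := qmin _ (convex_setE Cconv Cq Cy t01).
have := convex_functionE q y gconv t01.
have -> : `|x - (q + t *: (y - q))| ^+ 2 =
    `|x - q| ^+ 2 - 2 * t * inner (y - q) (x - q) + t ^+ 2 * `|y - q| ^+ 2.
  rewrite opprD addrA (sqr_normB (x - q)) innerZr (innerC (x - q)).
  by rewrite normrZ exprMn real_normK ?num_real//; ring.
move=> h1 h2; rewrite -(ler_pM2l t0).
have : t ^+ 2 * `|y - q| ^+ 2 <= t * e.
  by rewrite expr2 -mulrA ler_pM2l//; nra.
have : 0 <= t * e by rewrite mulr_ge0// ltW.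
by lra.
Qed.

End ProximalMinimization.

(** * Variational inequalities for cocoercive operators *)

Section VariationalInequality.
Context {R : realType} {H : hilbertType R}.
Implicit Types (x y : H) (C : set H) (B : H -> H).

Definition vi C B : set H :=
  [set x | C x /\ forall y, C y -> 0 <= inner (y - x) (B x)].

Definition cocoercive (c : R) B :=
  forall x y, c * `|B x - B y| ^+ 2 <= inner (x - y) (B x - B y).

Lemma cocoercive_monotone c B x y : 0 < c -> cocoercive c B ->
  0 <= inner (x - y) (B x - B y).
Proof.
by move=> c0 /(_ x y); apply: le_trans; rewrite mulr_ge0 ?sqr_ge0 ?ltW.
Qed.

Lemma cocoercive_continuous c B : 0 < c -> cocoercive c B -> continuous B.
Proof.
move=> c0 cB x; apply/cvgrPdist_lt => e e0.
have /cvgrPdist_lt/(_ _ (mulr_gt0 e0 c0)) : (fun y : H => y) @ x --> x.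
  exact: cvg_id.
apply: filterS => y xy.
have [->|Bxy] := eqVneq (B x) (B y); first by rewrite subrr normr0.
have B0 : 0 < `|B x - B y| by rewrite normr_gt0 subr_eq0.
have := le_trans (cB x y) (inner_le _ _).
rewrite expr2 mulrA ler_pM2r// => h.
by rewrite -(ltr_pM2r c0) mulrC; apply: le_lt_trans xy.
Qed.

Lemma projection_exists C : closed C -> convex_set C -> C !=set0 ->
  exists P : H -> H, forall x, C (P x) /\
    forall y, C y -> inner (y - P x) (x - P x) <= 0.
Proof.
move=> Cclosed Cconv C0; suff /choice[P PC] : forall x, exists q, C q /\
    forall y, C y -> inner (y - q) (x - q) <= 0 by exists P.
move=> x.
have g0 : convex_function setT (fun _ : H => 0 : R).
  by move=> t y z _ _; rewrite convRE !mulr0 addr0.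
have gc : continuous (fun _ : H => 0 : R) by move=> y; exact: cvg_cst.
have [q Cq qmin] := prox_minimizer_exists x gc g0 Cclosed Cconv C0.
exists q; split=> // y Cy; rewrite -[leRHS](subrr 0).
exact: (prox_variational g0 Cconv Cq qmin).
Qed.

(** Test the characterization of each projection at the other one, add, and use Cauchy-Schwarz. *)
Lemma projection_nonexpansive C (P : H -> H) :
  (forall x, C (P x) /\ forall y, C y -> inner (y - P x) (x - P x) <= 0) ->
  forall x y, `|P x - P y| <= `|x - y|.
Proof.
move=> PC x y.
have [->|Pxy] := eqVneq (P x) (P y); first by rewrite subrr normr0.
have P0 : 0 < `|P x - P y| by rewrite normr_gt0 subr_eq0.
rewrite -(ler_pM2r P0); apply: le_trans (inner_le _ _).
have [Px hx] := PC x; have [Py hy] := PC y.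
have := hx _ Py; have := hy _ Px; rewrite -expr2 sqr_normE !innerE.
rewrite (innerC (P y) x) (innerC (P y) (P x)) (innerC (P x) y) (innerC (P y) y)
  (innerC (P x) x); lra.
Qed.

Lemma forward_stepE (s e : R) x y a b :
  x - s *: (a + e *: x) - (y - s *: (b + e *: y)) =
  (1 - s * e) *: (x - y) - s *: (a - b).
Proof.
rewrite scalerBl scale1r -scalerA -[RHS]addrA -opprD -scalerDr scalerBr.
rewrite [e *: x - _ + _]addrACA -opprD scalerBr !opprB addrACA [RHS]addrACA.
by rewrite [- y + _]addrC (addrC (e *: x)) (addrC (e *: y)).
Qed.

Lemma tikhonov_exists C B c e : closed C -> convex_set C -> C !=set0 ->
  0 < c -> cocoercive c B -> 0 < e -> exists x, vi C (fun x => B x + e *: x) x.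
Proof.
move=> Cclosed Cconv C0 c0 cB e0.
have [P PC] := projection_exists Cclosed Cconv C0.
have ce0 : 0 < 1 + c * e by rewrite addr_gt0// mulr_gt0.
(* With this step size [s], the factor [1 - s * e] equals [q], and cocoercivity makes the cross term
   absorb [s ^+ 2 * |B x - B y| ^+ 2], so [T] contracts by [q]. *)
pose q := (1 + c * e)^-1; pose s := c * q.
have q0 : 0 < q by rewrite invr_gt0.
have s0 : 0 < s by rewrite mulr_gt0.
have q1 : q < 1 by rewrite invf_lt1// ltrDl mulr_gt0.
have qs : 1 - s * e = q by rewrite /s /q; field; rewrite gt_eqF.
pose T x := P (x - s *: (B x + e *: x)).
have Tq x y : `|T x - T y| <= q * `|x - y|.
  apply: le_trans (projection_nonexpansive PC _ _) _.
  rewrite -ler_sqr ?nnegrE ?mulr_ge0 ?(ltW q0)//.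
  rewrite forward_stepE qs.
  rewrite sqr_normB innerZl innerZr !normrZ !exprMn !real_normK ?num_real//.
  have cq : 0 < c * q ^+ 2 by rewrite mulr_gt0 ?exprn_gt0.
  have := ler_wpM2l (ltW cq) (cB x y).
  have := mulr_ge0 (ltW (mulr_gt0 cq c0)) (sqr_ge0 `|B x - B y|).
  by rewrite /s; lra.
pose Tfun : {fun [set: H] >-> [set: H]} := mkfun (fun x _ => I : setT (T x)).
have Tctr : is_contraction Tfun.
  by exists (NngNum (ltW q0)); split=> // -[x y] _ /=; exact: Tq.
have [|x _ xE] := banach_fixed_point Tctr closedT; first by exists 0.
have {}xE : x = T x by [].
exists x; have [Cx xP] := PC (x - s *: (B x + e *: x)).
rewrite -/(T x) -xE in Cx xP; split=> // y Cy.
have := xP y Cy; rewrite addrAC subrr add0r innerNr innerZr oppr_le0.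
by rewrite pmulr_rge0.
Qed.

(** Testing each inequality at the other solution and adding, monotonicity leaves
    [|x| ^+ 2 <= inner x y]. *)
Lemma tikhonov_sqr_dist C B c e d x y : 0 < c -> cocoercive c B ->
  0 < d -> d < e ->
  vi C (fun x => B x + e *: x) x -> vi C (fun x => B x + d *: x) y ->
  `|x - y| ^+ 2 <= `|y| ^+ 2 - `|x| ^+ 2.
Proof.
move=> c0 cB d0 de [Cx xP] [Cy yP].
have := xP y Cy; have := yP x Cx; have := cocoercive_monotone x y c0 cB.
have := sqr_ge0 `|x - y|; rewrite !sqr_normE !innerE (innerC y x).
move=> h1 h2 h3 h4.
have : (e - d) * inner x x <= (e - d) * inner x y by nra.
rewrite ler_pM2l ?subr_gt0//; lra.
Qed.

(* The Tikhonov path converges strongly as soon as it is bounded, so no weak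
   compactness is needed. *)
Lemma vi_exists C B c e0 K : closed C -> convex_set C -> C !=set0 ->
  0 < c -> cocoercive c B -> 0 < e0 ->
  (forall e x, 0 < e <= e0 -> vi C (fun x => B x + e *: x) x -> `|x| <= K) ->
  exists x, vi C B x.
Proof.
move=> Cclosed Cconv C0 c0 cB e00 bound.
pose e n := e0 * n.+1%:R^-1.
have e_gt0 n : 0 < e n by rewrite mulr_gt0 ?invr_gt0.
have e_le n : e n <= e0 by rewrite ger_pMr// invf_le1 ?ler1n ?ltr0n.
have e_dec n k : (n < k)%N -> e k < e n.
  by move=> nk; rewrite ltr_pM2l// ltf_pV2 ?posrE ?ltr0n// ltr_nat.
have e_cvg0 : e @ \oo --> 0.
  by rewrite -(mulr0 e0); apply: cvgMr; exact: cvg_harmonic.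
have /choice[u uP] n := tikhonov_exists Cclosed Cconv C0 c0 cB (e_gt0 n).
have u_dist n k : (n <= k)%N -> `|u n - u k| ^+ 2 <= `|u k| ^+ 2 - `|u n| ^+ 2.
  rewrite leq_eqVlt => /predU1P[->|nk]; first by rewrite !subrr normr0 expr0n.
  exact: tikhonov_sqr_dist c0 cB (e_gt0 k) (e_dec _ _ nk) (uP n) (uP k).
pose w n := `|u n| ^+ 2.
(* The squared norms increase and stay below [K ^+ 2]; their convergence forces that of [u] through
   [u_dist]. *)
have w_incr : {homo w : n k / (n <= k)%N >-> n <= k}.
  by move=> n k /u_dist h; rewrite -subr_ge0; apply: le_trans h; exact: sqr_ge0.
have w_cvg : cvgn w.
  apply: nondecreasing_is_cvgn => //; exists (K ^+ 2) => _ [n _ <-].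
  have uK : `|u n| <= K by apply: bound (uP n); rewrite e_gt0 e_le.
  by rewrite ler_sqr ?nnegrE// (le_trans _ uK).
have u_cvg : cvgn u.
  apply: (@is_cvg_sqr_dist _ _ _ (fun n => limn w - w n)).
    by rewrite -(subrr (limn w)); apply: cvgB w_cvg; exact: cvg_cst.
  move=> n k /u_dist h; apply: le_trans h _; rewrite lerD2r.
  exact: (nondecreasing_cvgn_le w_incr w_cvg k).
exists (limn u); split.
  by apply: closed_cvg u_cvg => //; apply: nearW => n; exact: (uP n).1.
move=> y Cy.
have Bu_cvg : (fun n => B (u n)) @ \oo --> B (limn u).
  by apply: cvg_comp u_cvg _; exact: cocoercive_continuous c0 cB _.
have eu_cvg : (fun n => B (u n) + e n *: u n) @ \oo --> B (limn u).
  rewrite -[B (limn u)]addr0 -(scale0r (limn u)).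
  exact: cvgD Bu_cvg (cvgZ e_cvg0 u_cvg).
have yu_cvg : (fun n => y - u n) @ \oo --> y - limn u.
  by apply: cvgB u_cvg; exact: cvg_cst.
apply: ler_cvg_to (@cvg_cst _ (0 : R) _ \oo _) (cvg_inner yu_cvg eu_cvg) _.
by apply: nearW => n; exact: (uP n).2.
Qed.

End VariationalInequality.

(** * Surjectivity of firmly nonexpansive operators *)

Section FirmlyNonexpansiveSurjectivity.
Context {R : realType} {G : hilbertType R}.
Implicit Types (F : G -> G) (x y : G).

(** On the whole space a variational inequality is an equation, and firm nonexpansiveness is
    cocoercivity with constant 1. *)
Lemma tikhonov_surjective F y e0 K : firmly_nonexpansive F -> 0 < e0 ->
  (forall e x, 0 < e <= e0 -> F x + e *: x = y -> `|x| <= K) ->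
  exists x, F x = y.
Proof.
move=> fF e00 bound; pose B x := F x - y.
have viT A x : vi [set: G] A x -> A x = 0.
  move=> [_ xP]; apply: inner_eq0 => z.
  by have := xP (z + x) I; rewrite addrK.
have convT : convex_set [set: G] by move=> x z t _ _; rewrite inE.
have cB : cocoercive 1 B.
  by move=> x z; rewrite mul1r /B opprB addrA subrK; exact: fF.
have [|e x ee0 /viT xy|x /viT xy] :=
  vi_exists (K := K) closedT convT _ ltr01 cB e00.
- by exists 0.
- by apply: bound ee0 _; apply/eqP; rewrite -subr_eq0 addrAC; apply/eqP.
- by exists x; exact: subr0_eq.
Qed.

(** Monotonicity gives [inner (e *: x) (F x - F 0) >= 0]. The bound is uniform in [e], even if [x]
    itself escapes to infinity. *)
Lemma tikhonov_image_bound F x y e : firmly_nonexpansive F -> 0 < e ->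
  F x + e *: x = y -> `|F x - F 0| <= `|y - F 0|.
Proof.
move=> fF e0 xy.
have [->|D0] := eqVneq (F x) (F 0); first by rewrite subrr normr0.
have {}D0 : 0 < `|F x - F 0| by rewrite normr_gt0 subr_eq0.
rewrite -(ler_pM2r D0); apply: le_trans (inner_le _ _).
rewrite -expr2 -xy addrAC innerDl innerZl -sqr_normE lerDl pmulr_rge0//.
by have := fF x 0; rewrite subr0; apply: le_trans; exact: sqr_ge0.
Qed.

Lemma norm_coercive_surjective F : firmly_nonexpansive F -> norm_coercive F ->
  set_surj setT setT F.
Proof.
move=> fF cF y _; have [N NF] := cF (`|y - F 0| + `|F 0|).
suff [x xy] : exists x, F x = y by exists x.
apply: (@tikhonov_surjective F y 1 N) => // e x /andP[e0 _] xy.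
rewrite leNgt; apply/negP => /NF; apply/negP; rewrite -leNgt.
rewrite -[F x](subrK (F 0)); apply: le_trans (ler_normD _ _) _.
by rewrite lerD2r; exact: tikhonov_image_bound fF e0 xy.
Qed.

Lemma bounded_residual_norm_coercive F :
  bounded_set (range (fun y => y - F y)) -> norm_coercive F.
Proof.
(* [bounded_set] only gives bounds strictly above [M], hence [M + 1]. *)
move=> [M [Mreal FM]] N; exists (N + (M + 1)) => y Ny.
have M1 : M < M + 1 by rewrite ltrDl.
have /= : `|y - F y| <= M + 1 by apply: FM M1 _ _; exists y.
have : `|y| <= `|y - F y| + `|F y|.
  by rewrite -[in leLHS](subrK (F y) y); exact: ler_normD.
lra.
Qed.

Lemma prox_variationalT (g : G -> R) x z : continuous g ->
  convex_function setT g ->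
  inner (z - prox (EFin \o g) x) (x - prox (EFin \o g) x) <=
  g z - g (prox (EFin \o g) x).
Proof.
move=> gc gv; have convT : convex_set [set: G] by move=> ? ? ? _ _; rewrite inE.
apply: (@prox_variational _ _ _ setT) => // y _.
rewrite /prox; case: xgetP => [q _ qmin|nomin].
  by have := qmin y; rewrite /= -!EFinD lee_fin.
(* A minimizer exists, so the default value of [prox] is never taken. *)
have [|q _ qmin] := prox_minimizer_exists x gc gv closedT convT.
  by exists 0.
by case: (nomin q) => u; rewrite /= -!EFinD lee_fin; exact: qmin.
Qed.

(* With q = prox_g x, the vector x - q is a subgradient of g at q; as e -> 0 the
   point q tends to y, near which subgradients of g are bounded. *)
Lemma prox_surjective F (g : G -> R) : firmly_nonexpansive F ->
  continuous g -> convex_function setT g -> F = prox (EFin \o g) ->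
  set_surj setT setT F.
Proof.
move=> fF gc gv FE y _.
suff [x xy] : exists x, F x = y by exists x.
have subgrad x z : inner (z - F x) (x - F x) <= g z - g (F x).
  by rewrite FE; exact: prox_variationalT.
(* [- F 0] is a subgradient of [g] at [F 0], so [m] bounds [g] below on the ball of radius [r]
   around [F 0], which contains every [F x] considered. *)
pose r := `|y - F 0|; pose m := g (F 0) - r * `|F 0|.
have r0 : 0 <= r by exact: normr_ge0.
have image_bound e x : 0 < e -> F x + e *: x = y ->
    [/\ `|F x| <= r + `|F 0|, `|y - F x| <= 2 * r & m <= g (F x)].
  move=> e0 xy; have Fr := tikhonov_image_bound fF e0 xy; split.
  - rewrite -[F x](subrK (F 0)); apply: le_trans (ler_normD _ _) _.
    by rewrite lerD2r.
  - rewrite -(subrKA (F 0)); apply: le_trans (ler_normD _ _) _.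
    by rewrite (distrC (F 0)); rewrite -/r; move: Fr; rewrite -/r; lra.
  - have := subgrad 0 (F x); rewrite sub0r innerNr.
    have := le_trans (inner_le _ _) (ler_wpM2r (normr_ge0 (F 0)) Fr).
    by rewrite -/r /m; lra.
(* The first two terms bound [e * |x| ^+ 2], by the subgradient inequality at [y]; the 1 makes [M]
   positive. *)
pose M := `|g y - m| + 2 * r * (r + `|F 0|) + 1.
have M0 : 0 < M by rewrite ltr_wpDl// addr_ge0 ?mulr_ge0// addr_ge0.
have near_y e x : 0 < e -> F x + e *: x = y -> `|F x - y| ^+ 2 <= e * M.
  move=> e0 xy; have [Fx yFx mFx] := image_bound e x e0 xy.
  have ex : y - F x = e *: x by rewrite -xy addrC addKr.
  have -> : `|F x - y| ^+ 2 = e * (e * `|x| ^+ 2).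
    by rewrite distrC ex normrZ gtr0_norm// exprMn expr2 mulrA.
  rewrite ler_pM2l//.
  have := subgrad x y; rewrite innerDr innerNr {1}ex innerZl -sqr_normE.
  have := inner_le (y - F x) (F x).
  have : `|y - F x| * `|F x| <= 2 * r * (r + `|F 0|) by rewrite ler_pM.
  have := ler_norm (g y - m).
  rewrite /M; lra.
have /nbhs_ballP[d /= d0 gd] : \forall z \near y, `|g y - g z| < 1.
  exact: cvgr_dist_lt (gc y) _ ltr01.
(* Both [F x - y] and the perturbation [h] below have norm at most [s], so [F x + h] stays in the
   ball of radius [d]. *)
pose s := d / 3; have s0 : 0 < s by rewrite divr_gt0.
apply: (@tikhonov_surjective F y (s ^+ 2 / M)
  (`|g y + 1 - m| / s + (r + `|F 0|))) => //.
  by rewrite divr_gt0 ?exprn_gt0.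
move=> e x /andP[e0 es] xy; have [Fx _ mFx] := image_bound e x e0 xy.
have Fxy : `|F x - y| <= s.
  rewrite -ler_sqr ?nnegrE ?(ltW s0)//; apply: le_trans (near_y _ _ e0 xy) _.
  by rewrite -ler_pdivlMr.
rewrite -[x in leLHS](subrK (F x)); apply: le_trans (ler_normD _ _) _.
apply: lerD => //; rewrite ler_pdivlMr//.
have [xF|xF] := eqVneq x (F x); first by rewrite -xF subrr normr0 mul0r.
have {}xF : 0 < `|x - F x| by rewrite normr_gt0 subr_eq0.
(* Moving from [F x] along its own subgradient raises [g] by at least [s * |x - F x|], while [g]
   stays below [g y + 1] there. *)
pose h := (s / `|x - F x|) *: (x - F x).
have hs : `|h| = s.
  by rewrite normrZ gtr0_norm ?divr_gt0// divfK// gt_eqF.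
have /gd /= : ball y d (F x + h).
  rewrite -ball_normE /= distrC addrAC; apply: le_lt_trans (ler_normD _ _) _.
  by rewrite hs; move: Fxy s0; rewrite /s; lra.
have := subgrad x (F x + h).
rewrite addrAC subrr add0r innerZl -sqr_normE expr2 mulrA divfK ?gt_eqF//.
have := ler_norm (g y + 1 - m); rewrite ltr_norml mulrC; lra.
Qed.

End FirmlyNonexpansiveSurjectivity.

(** * Uniform boundedness for sets of vectors *)

Section WeakBoundedness.
Context {R : realType} {H : hilbertType R}.

Lemma inner_sumr (I : Type) (s : seq I) (x : H) (u : I -> H) :
  inner x (\sum_(i <- s) u i) = \sum_(i <- s) inner x (u i).
Proof.
apply: (big_morph (inner x)); first by move=> y z; exact: innerDr.
by rewrite innerC inner0l.
Qed.

(** Banach-Steinhaus for the functionals [inner x]; one-sided bounds suffice, since [w] and [- w]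
    are both available. *)
Lemma weakly_bounded_bounded (S : set H) :
  (forall w, exists K, forall x, S x -> inner x w <= K) ->
  exists K, forall x, S x -> `|x| <= K.
Proof.
move=> Sw; pose f x : H -> R^o := inner x.
have [|w|K SK] := @Banach_Steinhauss R H R^o (f @` S) _ _ 1.
- move=> _ [x _ <-]; split.
    move=> r; exists (`|x| * r) => y yr.
    by apply: le_trans (normr_inner_le _ _) _; rewrite ler_wpM2l.
  by move=> a y z; rewrite /f innerDr innerZr.
- have [K1 h1] := Sw w; have [K2 h2] := Sw (- w).
  exists (Num.max K1 K2) => _ [x Sx <-]; rewrite ler_norml /f.
  have := h1 x Sx; have := h2 x Sx; rewrite innerNr => {}h2 {}h1.
  by rewrite lerNl !le_max h2 h1 orbT.
exists K => x Sx.
have [->|x0] := eqVneq x 0.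
  have := SK _ (ex_intro2 _ _ x Sx erefl) 0.
  by rewrite !normr0 => /(_ ler01); apply: le_trans.
have nx : 0 < `|x| by rewrite normr_gt0.
have := SK _ (ex_intro2 _ _ x Sx erefl) (`|x|^-1 *: x).
rewrite normrZ normfV normr_id mulVf ?gt_eqF// => /(_ (lexx _)).
by rewrite /f innerZr -sqr_normE expr2 mulKf ?gt_eqF// normr_id.
Qed.

End WeakBoundedness.

(** * The weighted operator on [H] and the instances of the problem *)

Section AggregatedOperator.
Context {R : realType} {I : finType} {H : hilbertType R}.
Context {G : I -> hilbertType R}.
Variables (omega : I -> R) (C : set H) (p : forall i, G i).
Variables (L : forall i, {linear H -> G i}) (F : forall i, G i -> G i).
Arguments F : clear implicits.
Hypothesis omega_itv : forall i, 0 < omega i <= 1.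
Hypothesis omega_sum : \sum_i omega i = 1.
Hypothesis C_nonempty : C !=set0.
Hypothesis C_closed : closed C.
Hypothesis C_convex : convex_set C.
Hypothesis L_bounded : forall i, bounded_operator (L i).
Hypothesis F_fne : forall i, firmly_nonexpansive (F i).

Let omega_gt0 i : 0 < omega i.
Proof. by have /andP[] := omega_itv i. Qed.

Let target := \sum_i omega i *: adjoint (L i) (p i).

Definition aggregate (x : H) : H :=
  \sum_i omega i *: adjoint (L i) (F i (L i x)).

Let inner_adjoint_sum x (v : forall i, G i) :
  inner x (\sum_i omega i *: adjoint (L i) (v i)) =
  \sum_i omega i * inner (L i x) (v i).
Proof.
by rewrite inner_sumr; apply: eq_bigr => i _; rewrite innerZr -adjointP.
Qed.

Lemma VI_solutionE x :
  VI_solution omega C p L F x <-> vi C (fun x => aggregate x - target) x.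
Proof.
have E y : inner (y - x) (aggregate x - target) =
    \sum_i omega i * inner (L i (y - x)) (F i (L i x) - p i).
  rewrite innerDr innerNr !inner_adjoint_sum -sumrB.
  by apply: eq_bigr => i _; rewrite innerDr innerNr mulrBr.
by split=> -[Cx xP]; split=> // y Cy; have := xP y Cy; rewrite E.
Qed.

Lemma aggregate_cocoercive : exists2 c, 0 < c & cocoercive c aggregate.
Proof.
have /choice[N NL] : forall i, exists N, forall x, `|L i x| <= N * `|x|.
  by move=> i; exact: L_bounded.
(* A positive bound common to all [L i]; each [N i] may be negative, hence the absolute values. *)
pose M := 1 + \sum_i `|N i|.
have sumN : 0 <= \sum_i `|N i| by exact: sumr_ge0.
have M0 : 0 < M by rewrite ltr_pwDl.
have LM i x : `|L i x| <= M * `|x|.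
  apply: le_trans (NL i x) _; rewrite ler_wpM2r//.
  apply: le_trans (ler_norm _) _; rewrite /M (bigD1 i)//= addrCA lerDl.
  by rewrite addr_ge0// sumr_ge0.
exists (M ^- 2); first by rewrite invr_gt0 exprn_gt0.
move=> x y; rewrite mulrC ler_pdivrMr ?exprn_gt0// mulrC.
set E := aggregate x - aggregate y.
pose D i := F i (L i x) - F i (L i y).
have EE z : inner z E = \sum_i omega i * inner (L i z) (D i).
  rewrite innerDr innerNr !inner_adjoint_sum -sumrB.
  by apply: eq_bigr => i _; rewrite innerDr innerNr mulrBr.
pose S := \sum_i omega i * `|D i| ^+ 2.
have S_le : S <= inner (x - y) E.
  rewrite EE; apply: ler_sum => i _; rewrite ler_pM2l// (linearB (L i)).
  exact: (@F_fne i).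
(* Termwise Young inequality; since the weights sum to 1, the halves of [|E| ^+ 2] can be
   distributed over the sum. *)
suff : `|E| ^+ 2 <= `|E| ^+ 2 / 2 + M ^+ 2 / 2 * S.
  have := ler_wpM2l (sqr_ge0 M) S_le; lra.
have -> : `|E| ^+ 2 / 2 + M ^+ 2 / 2 * S =
    \sum_i omega i * (`|E| ^+ 2 / 2 + M ^+ 2 / 2 * `|D i| ^+ 2).
  rewrite -[X in X + _]mul1r -omega_sum mulr_suml mulr_sumr -big_split/=.
  by apply: eq_bigr => i _; ring.
rewrite [leLHS]sqr_normE EE; apply: ler_sum => i _; rewrite ler_pM2l//.
apply: le_trans (inner_le _ _) _.
apply: le_trans (ler_wpM2r (normr_ge0 _) (LM i E)) _.
have := sqr_ge0 (`|E| - M * `|D i|); lra.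
Qed.

Lemma aggregate_vi_exists e0 K : 0 < e0 ->
  (forall e x, 0 < e <= e0 ->
     vi C (fun x => aggregate x - target + e *: x) x -> `|x| <= K) ->
  exists x, VI_solution omega C p L F x.
Proof.
have [c c0 cB] := aggregate_cocoercive => e00 bound.
have cBt : cocoercive c (fun x => aggregate x - target).
  by move=> x y; rewrite opprB addrA subrK; exact: cB.
have [x xP] := vi_exists C_closed C_convex C_nonempty c0 cBt e00 bound.
by exists x; apply/VI_solutionE.
Qed.

(** The range condition says that [target - aggregate x] is normal to [C] at [x]. *)
Lemma VI_solution_of_ran :
  ran (opadd (normal_cone C) (single_valued aggregate)) target ->
  exists x, VI_solution omega C p L F x.
Proof.
move=> [x [a [Cx aP] [_ -> ar]]]; exists x; apply/VI_solutionE; split=> // y Cy.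
by rewrite -ar opprD addrCA subrr addr0 innerNr oppr_ge0; exact: aP.
Qed.

Lemma VI_solution_of_bounded : bounded_set C ->
  exists x, VI_solution omega C p L F x.
Proof.
move=> [M [_ CM]]; apply: (@aggregate_vi_exists 1 (M + 1)) => // e x _ [Cx _].
by apply: CM Cx; rewrite ltrDl.
Qed.

(* The 3* monotonicity estimate behind the Brezis-Haraux theorem. *)
Let firmly_nonexpansive_3star i z (t : G i) x :
  inner (L i (x - z)) (F i t) - `|t - L i z| ^+ 2 <=
  inner (L i (x - z)) (F i (L i x)).
Proof.
have := F_fne (L i x) t; set D := F i (L i x) - F i t => fD.
rewrite -subr_ge0 opprB addrCA -innerNr -innerDr -/D.
have -> : L i (x - z) = (L i x - t) + (t - L i z).
  by rewrite subrKA (linearB (L i)).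
rewrite innerDl; have := inner_le (- (t - L i z)) D; rewrite innerNl normrN.
have := sqr_ge0 (`|D| - `|t - L i z|); have := sqr_ge0 `|D|.
have := sqr_ge0 `|t - L i z|; lra.
Qed.

Lemma VI_solution_of_sum_ran :
  setadd (ran (normal_cone C))
    (setsum (fun i =>
       [set omega i *: v | v in adjoint (L i) @` range (F i)])) = [set: H] ->
  exists x, VI_solution omega C p L F x.
Proof.
move=> sum_ran; have [z Cz] := C_nonempty.
pose S := [set x | exists2 e, 0 < e <= 1 &
  vi C (fun x => aggregate x - target + e *: x) x].
suff [K SK] : exists K, forall x, S x -> `|x| <= K.
  apply: (@aggregate_vi_exists 1 K) => // e x e01 xP.
  by apply: SK; exists e.
apply: weakly_bounded_bounded => w.
have : [set: H] (target + w) by [].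
rewrite -sum_ran => -[a [y [Cy aP]] [_ [s sP ->] abw]].
have /choice[k kP] : forall i, exists k, forall x,
    inner (x - z) (s i) - k <= omega i * inner (L i (x - z)) (F i (L i x)).
  move=> i; have [_ [_ [t _ <-] <-] <-] := sP i.
  exists (omega i * `|t - L i z| ^+ 2) => x.
  by rewrite innerZr -adjointP// -mulrBr ler_pM2l.
(* The terms come from normality of [a] at [y], the estimates [kP], the regularization with
   [e <= 1], and the shift from [x - z] to [x]. *)
exists (inner (y - z) a + \sum_i k i + `|z| ^+ 2 + inner z w).
move=> x [e /andP[e0 e1] [Cx /(_ z Cz)]].
have -> : z - x = - (x - z) by rewrite opprB.
rewrite innerNl oppr_ge0 !innerDr innerNr innerZr inner_adjoint_sum => xz.
have : inner (x - z) (\sum_i s i) - \sum_i k i <=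
    \sum_i omega i * inner (L i (x - z)) (F i (L i x)).
  by rewrite inner_sumr -sumrB; apply: ler_sum => i _; exact: kP.
have := congr1 (inner (x - z)) abw; rewrite !innerDr => abwx.
have := aP x Cx.
have -> : inner x w = inner (x - z) w + inner z w by rewrite -innerDl subrK.
have -> : inner (y - z) a = inner (x - z) a - inner (x - y) a.
  rewrite -innerNl -innerDl (_ : y - z = x - z - (x - y))//.
  by rewrite opprB [RHS]addrC subrKA.
have : - (e * inner (x - z) x) <= `|z| ^+ 2.
  have : - inner (x - z) x <= `|z| ^+ 2.
    rewrite innerDl innerNl -sqr_normE.
    have := inner_le z x; have := sqr_ge0 (`|x| - `|z|); have := sqr_ge0 `|z|.
    have := sqr_ge0 `|x|; lra.
  have := sqr_ge0 `|z|; nra.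
lra.
Qed.

(** The [i]-th summand alone fills the space, so the others are frozen at [F j 0] and the normal
    vector at 0. *)
Lemma sum_ran_of_surjective i : adjoint (L i) @` range (F i) = [set: H] ->
  setadd (ran (normal_cone C))
    (setsum (fun i =>
       [set omega i *: v | v in adjoint (L i) @` range (F i)])) = [set: H].
Proof.
move=> LF; apply/seteqP; split=> // w _; have [z Cz] := C_nonempty.
pose s j := omega j *: adjoint (L j) (F j 0).
pose t := w - \sum_(j | j != i) s j.
exists 0; first by exists z; split=> // y _; rewrite innerC inner0l.
exists w; last by rewrite add0r.
exists (fun j => if j == i then t else s j); last first.
  rewrite (bigD1 i)//= eqxx (eq_bigr s) ?subrK// => j /negPf ->.
  by [].
move=> j; case: eqVneq => [->|_]; last first.
  by exists (adjoint (L j) (F j 0)) => //; exists (F j 0) => //; exists 0.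
exists ((omega i)^-1 *: t); first by rewrite LF.
by rewrite scalerA divff ?scale1r// gt_eqF.
Qed.

End AggregatedOperator.

Theorem proposition4p3 (R : realType) (I : finType) (omega : I -> R)
    (H : hilbertType R) (C : set H) (G : I -> hilbertType R)
    (p : forall i, G i) (L : forall i, {linear H -> G i})
    (F : forall i, G i -> G i)
    (I_nonempty : (0 < #|I|)%N)
    (omega_itv : forall i, 0 < omega i <= 1)
    (omega_sum : \sum_i omega i = 1)
    (C_nonempty : C !=set0) (C_closed : closed C) (C_convex : convex_set C)
    (L_bounded : forall i, bounded_operator (L i))
    (L_neq0 : forall i, exists x, L i x != 0)
    (F_fne : forall i, firmly_nonexpansive (F i)) :
  (ran (opadd (normal_cone C)
          (single_valued
             (fun x => \sum_i omega i *: adjoint (L i) (F i (L i x)))))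
     (\sum_i omega i *: adjoint (L i) (p i))
   \/ bounded_set C
   \/ setadd (ran (normal_cone C))
        (setsum (fun i =>
           [set omega i *: v | v in adjoint (L i) @` range (F i)]))
      = [set: H]
   \/ exists i, set_surj [set: G i] [set: H] (adjoint (L i)) /\
      (adjoint (L i) @` range (F i) = [set: H]
       \/ set_surj [set: G i] [set: G i] (F i)
       \/ norm_coercive (F i)
       \/ bounded_set (range (fun y => y - F i y))
       \/ exists g : G i -> R,
            [/\ continuous g, convex_function setT g
              & F i = prox (EFin \o g)])) ->
  exists x, VI_solution omega C p L F x.
Proof.
case=> [|[|[|[i [Lsurj inst]]]]].
- exact: VI_solution_of_ran.
- exact: VI_solution_of_bounded.
- exact: VI_solution_of_sum_ran.
apply: VI_solution_of_sum_ran => //.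
apply: (@sum_ran_of_surjective _ _ _ _ _ _ _ _ _ _ i) => //.
(* Surjectivity of [F i] yields the first alternative, so the remaining ones need only provide
   it. *)
have {Lsurj} reduce : set_surj setT setT (F i) ->
    adjoint (L i) @` range (F i) = [set: H].
  move=> Fsurj; apply/seteqP; split=> // u _.
  have [v _ <-] := Lsurj u Logic.I; have [y _ <-] := Fsurj v Logic.I.
  by exists (F i y) => //; exists y.
case: inst => [//|[Fsurj|[Fcoer|[Fres|[g [gc gv FE]]]]]]; apply: reduce => //.
- exact: norm_coercive_surjective.
- exact/norm_coercive_surjective/bounded_residual_norm_coercive.
- exact: prox_surjective gc gv FE.
Qed.
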